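(* There does not exist a graph $G$ with a vertex $v\in V(G)$ such that $\gamma_g(G)=4$ and $\gamma_g(G-v)=2$.
   Context: Graphs are finite, simple and undirected. A vertex dominates itself and all its neighbors. The domination game on a graph $G$ is played by two players, Dominator and Staller, who alternately choose a vertex of $G$ such that each chosen vertex dominates at least one vertex that was not dominated by the previously chosen vertices. The game ends when all vertices of $G$ are dominated. Dominator wants the total number of chosen vertices to be as small as possible, Staller wants it to be as large as possible. Assuming both play optimally, $\gamma_g(G)$ (the game domination number) is the total number of vertices chosen when Dominator moves first. $G-v$ denotes the graph obtained from $G$ by removing the vertex $v$ and all edges incident with it. *)

(* Defs.v *)
From mathcomp Require Import all_boot.

Set Implicit Arguments.
Unset Strict Implicit.
Unset Printing Implicit Defensive.

Record sgraph := SGraph {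
  vertex :> finType;
  adj : rel vertex;
  adj_sym : symmetric adj;
  adj_irrefl : irreflexive adj }.

Section VertexRemoval.
Variables (G : sgraph) (v : G).

Definition del_adj : rel {x : G | x != v} := fun x y => adj (val x) (val y).

Lemma del_adj_sym : symmetric del_adj.
Proof. by move=> x y; apply: adj_sym. Qed.

Lemma del_adj_irrefl : irreflexive del_adj.
Proof. by move=> x; apply: adj_irrefl. Qed.

Definition del_vertex : sgraph := SGraph del_adj_sym del_adj_irrefl.
End VertexRemoval.

Inductive player := Dominator | Staller.

Lemma bigminn_le (I : finType) (m : nat) (P : pred I) (F : I -> nat) (i : I) :
  P i -> \big[minn/m]_(j | P j) F j <= F i.
Proof.
move=> Pi; have := mem_index_enum i; elim: (index_enum I) => // j r IHr.
rewrite inE big_cons => /predU1P[<-|/IHr le_r]; first by rewrite Pi geq_minl.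
by case: ifP => // _; rewrite geq_min le_r orbT.
Qed.

Section DominationGame.
Variable G : sgraph.
Implicit Types (x : G) (D : {set G}).

Definition dominated_by x : {set G} := [set y | (y == x) || adj x y].

(* A position of the game is the set D of vertices dominated so far. *)
Definition legal D x : bool := ~~ (dominated_by x \subset D).

Definition play D x : {set G} := D :|: dominated_by x.

(* Number of moves still to be made from position D under optimal play, by
   backward induction. The first argument is fuel: each legal move dominates a
   new vertex, so #|~: D| is always enough (moves_leftE). At most #|G| moves
   are ever made (moves_left_le), so the default value #|G| of the minimum is
   an upper bound of its terms; moves_left_DominatorP and
   moves_left_StallerP give the resulting optimality of the moves. *)
Fixpoint moves_left_fuel (n : nat) (p : player) D : nat :=
  if n is n'.+1 then
    if D == [set: G] then 0
    else (match p with
          | Dominator => \big[minn/#|G|]_(x | legal D x)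
                           moves_left_fuel n' Staller (play D x)
          | Staller => \max_(x | legal D x)
                           moves_left_fuel n' Dominator (play D x)
          end).+1
  else 0.

Definition moves_left (p : player) D : nat := moves_left_fuel #|~: D| p D.

Definition game_domination_number : nat := moves_left Dominator set0.

Lemma legal_exists D : D != [set: G] -> exists x, legal D x.
Proof.
rewrite -subTset => /subsetPn[x _ xD]; exists x.
by apply/subsetPn; exists x => //; rewrite inE eqxx.
Qed.

Lemma legal_card D x : legal D x -> #|~: play D x| < #|~: D|.
Proof.
case/subsetPn=> y yx yD; apply: proper_card; apply/properP; split.
  by rewrite setCS subsetUl.
by exists y; rewrite in_setC ?yD // in_setU yx orbT.
Qed.

Lemma moves_left_fuel_irr n m p D :
  #|~: D| <= n -> #|~: D| <= m -> moves_left_fuel n p D = moves_left_fuel m p D.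
Proof.
have fullE k D' : D' == [set: G] -> forall q, moves_left_fuel k q D' = 0.
  by move=> DT q; case: k => //= k; rewrite DT.
have full0 D' : #|~: D'| <= 0 -> D' == [set: G].
  by rewrite leqn0 cards_eq0 => /eqP D'0; rewrite -(setCK D') D'0 setC0.
elim: n m p D => [|n IHn] [|m] p D Dn Dm //.
- by rewrite [RHS]fullE ?full0.
- by rewrite [LHS]fullE ?full0.
rewrite /=; case: ifP => // _; case: p; congr _.+1;
  apply: eq_bigr => x /legal_card xD; apply: IHn; rewrite -ltnS;
  exact: leq_trans xD _.
Qed.

Lemma moves_leftE p D :
  moves_left p D =
    if D == [set: G] then 0
    else (match p with
          | Dominator => \big[minn/#|G|]_(x | legal D x)
                           moves_left Staller (play D x)
          | Staller => \max_(x | legal D x) moves_left Dominator (play D x)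
          end).+1.
Proof.
rewrite {1}/moves_left (@moves_left_fuel_irr _ #|~: D|.+1) //=.
case: ifP => // _; case: p; congr _.+1; apply: eq_bigr => x xD;
  apply: moves_left_fuel_irr => //; exact: ltnW (legal_card xD).
Qed.

Lemma moves_left_le p D : moves_left p D <= #|~: D|.
Proof.
have [n] := ubnP #|~: D|; elim: n p D => // n IHn p D Dn.
rewrite moves_leftE; case: ifPn => // DT.
have le_step q x : legal D x -> moves_left q (play D x) < #|~: D|.
  move=> /legal_card xD; apply: (leq_ltn_trans _ xD); apply: IHn.
  exact: leq_trans xD _.
have [x xD] := legal_exists DT.
case: p.
  exact: leq_ltn_trans (bigminn_le _ _ xD) (le_step _ _ xD).
have D0 : 0 < #|~: D| by apply: leq_ltn_trans (leq0n _) (legal_card xD).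
rewrite -(prednK D0) ltnS; apply/bigmax_leqP => y yD.
by rewrite -ltnS prednK // le_step.
Qed.

Lemma moves_left_DominatorP D : D != [set: G] ->
  exists x, [/\ legal D x,
    moves_left Dominator D = (moves_left Staller (play D x)).+1 &
    forall y, legal D y ->
      moves_left Staller (play D x) <= moves_left Staller (play D y)].
Proof.
move=> DT; have [x0 x0D] := legal_exists DT.
have [x xD xmin] :=
  arg_minnP (fun y => moves_left Staller (play D y)) x0D.
exists x; split=> //; rewrite moves_leftE (negPf DT); congr _.+1.
apply/eqP; rewrite eqn_leq bigminn_le //=.
elim/big_ind: _ => [|a b xa xb|y /xmin //]; last by rewrite leq_min xa xb.
exact: leq_trans (moves_left_le _ _) (max_card _).
Qed.

Lemma moves_left_StallerP D : D != [set: G] ->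
  exists x, [/\ legal D x,
    moves_left Staller D = (moves_left Dominator (play D x)).+1 &
    forall y, legal D y ->
      moves_left Dominator (play D y) <= moves_left Dominator (play D x)].
Proof.
move=> DT; have [x0 x0D] := legal_exists DT.
have [x xD xmax] :=
  arg_maxnP (fun y => moves_left Dominator (play D y)) x0D.
exists x; split=> //; rewrite moves_leftE (negPf DT); congr _.+1.
apply/eqP; rewrite eqn_leq; apply/andP; split; first exact/bigmax_leqP.
exact: leq_bigmax_cond.
Qed.
End DominationGame.

(* Main.v *)
Require Import Defs.
From mathcomp Require Import all_boot.

Set Implicit Arguments.
Unset Strict Implicit.
Unset Printing Implicit Defensive.

(** An optimal first move [d] in [G - v] leaves undominated a nonempty set [U]
    such that every vertex of [G - v] dominating one vertex of [U] dominates
    all of it; in particular each vertex of [U] dominates [U]. If Dominator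
    plays [d] in [G], at most [U] and [v] remain. Any reply of Staller either
    dominates [v], and Dominator finishes with a vertex of [U], or dominates
    all of [U], and Dominator finishes with [v]. So the game on [G] lasts at
    most three moves. *)

Section MovesLeft.
Variable G : sgraph.
Implicit Types (x : G) (D : {set G}) (p : player).

Lemma moves_left_eq0 p D : (moves_left p D == 0) = (D == [set: G]).
Proof. by rewrite moves_leftE; case: ifP. Qed.

Lemma moves_left_Dominator_leS D x :
  legal D x -> moves_left Dominator D <= (moves_left Staller (play D x)).+1.
Proof.
move=> xD; rewrite moves_leftE; case: ifP => // _; rewrite ltnS.
exact: (bigminn_le _ (fun y => moves_left Staller (play D y))).
Qed.

Lemma moves_left_Staller_leS D k :
  (forall x, legal D x -> moves_left Dominator (play D x) <= k) ->
  moves_left Staller D <= k.+1.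
Proof.
by move=> le_k; rewrite moves_leftE; case: ifP => // _; apply/bigmax_leqP.
Qed.

Lemma moves_left_Staller_gt D x :
  legal D x -> moves_left Dominator (play D x) < moves_left Staller D.
Proof.
move=> xD; rewrite [X in _ < X]moves_leftE; case: eqP => [DT|_].
  by rewrite /legal DT subsetT in xD.
exact: (@leq_bigmax_cond _ (legal D) (fun y => moves_left Dominator (play D y))).
Qed.

(** This also covers the case where the game is already over, so a finishing vertex can be named
    without checking that it is legal. *)
Lemma moves_left_Dominator_le1 D x :
  play D x = [set: G] -> moves_left Dominator D <= 1.
Proof.
move=> DxT; have [xD|] := boolP (legal D x).
  apply: leq_trans (moves_left_Dominator_leS xD) _.
  by rewrite ltnS leqn0 moves_left_eq0 DxT.
(* An illegal [x] adds nothing to [D], so [D] is already everything. *)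
rewrite negbK => /setUidPl Dx; rewrite leqW // leqn0 moves_left_eq0.
by rewrite -DxT /play Dx.
Qed.

Lemma mem_dominated_by_self x : x \in dominated_by x.
Proof. by rewrite inE eqxx. Qed.

Lemma game_domination_number_le3 d :
  (forall s, legal (dominated_by d) s ->
     exists w, dominated_by d :|: dominated_by s :|: dominated_by w = [set: G]) ->
  game_domination_number G <= 3.
Proof.
move=> win; have d0 : legal set0 d.
  by apply/subsetPn; exists d; rewrite ?mem_dominated_by_self ?inE.
apply: leq_trans (moves_left_Dominator_leS d0) _; rewrite ltnS.
rewrite /play set0U; apply: moves_left_Staller_leS => s /win[w].
exact: moves_left_Dominator_le1.
Qed.

(** After an optimal [d] the value for Staller is 1: some vertex is left, and every legal reply ends
    the game. A vertex dominating some [y] missed by [d] is such a reply. *)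
Lemma game_domination_number_eq2 :
  game_domination_number G = 2 ->
  exists d, (exists u, u \notin dominated_by d) /\
    forall x y z, y \notin dominated_by d -> z \notin dominated_by d ->
      y \in dominated_by x -> z \in dominated_by x.
Proof.
rewrite /game_domination_number => G2.
have G0 : set0 != [set: G] by rewrite -(moves_left_eq0 Dominator) G2.
have [d [_]] := moves_left_DominatorP G0.
rewrite G2 /play set0U => -[Sd] _; exists d; split.
  have: dominated_by d != [set: G] by rewrite -(moves_left_eq0 Staller) -Sd.
  by rewrite -subTset => /subsetPn[u _ ud]; exists u.
move=> x y z yd zd yx; have xd : legal (dominated_by d) x.
  by apply/subsetPn; exists y.
have := moves_left_Staller_gt xd; rewrite -Sd ltnS leqn0 moves_left_eq0.
by move=> /eqP/setP/(_ z); rewrite !in_setU in_setT (negPf zd).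
Qed.

End MovesLeft.

Lemma dominated_by_del_vertex (G : sgraph) (v : G) (x y : del_vertex v) :
  (y \in dominated_by x) = (val y \in dominated_by (val x)).
Proof. by rewrite !inE. Qed.

Lemma del_vertex_game_domination_number_eq2 (G : sgraph) (v : G) :
  game_domination_number (del_vertex v) = 2 -> game_domination_number G <= 3.
Proof.
case/game_domination_number_eq2=> d [[u ud] twin].
apply: (@game_domination_number_le3 _ (val d)) => s legal_s.
have [vs|vNs] := boolP (v \in dominated_by (val d) :|: dominated_by s).
  (* Only vertices missed by [d] matter: [u] is one and dominates itself, so by [twin] it dominates
     all of them. *)
  exists (val u); apply/setP => z; rewrite in_setU in_setT.
  have [-> | zv] := eqVneq z v; first by rewrite vs.
  pose z' : del_vertex v := Sub z zv.
  have [zd | zd] := boolP (z' \in dominated_by d).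
    by rewrite dominated_by_del_vertex in zd; rewrite in_setU zd.
  rewrite -[z]/(val z') -!dominated_by_del_vertex.
  by rewrite (twin u u z' ud zd (mem_dominated_by_self _)) orbT.
exists v; apply/setP => z; rewrite !in_setU in_setT.
have [-> | zv] := eqVneq z v; first by rewrite mem_dominated_by_self !orbT.
rewrite in_setU negb_or in vNs; case/andP: vNs => _ vNs.
(* If [s], or the vertex [y] it newly dominates, were [v], then [s] would dominate [v]. So both lie
   in [del_vertex v], where [twin] applies to them. *)
have sv : s != v.
  by apply: contraNneq vNs => ->; apply: mem_dominated_by_self.
have [y ys yd] := subsetPn legal_s.
have yv : y != v by apply: contraNneq vNs => <-.
pose z' : del_vertex v := Sub z zv; pose y' : del_vertex v := Sub y yv.
pose s' : del_vertex v := Sub s sv.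
rewrite -[z]/(val z') -[s]/(val s') -!dominated_by_del_vertex.
have [//|zd] := boolP (z' \in dominated_by d).
by rewrite (twin s' y' z' _ zd) // dominated_by_del_vertex.
Qed.

Theorem mainTheorem19 :
  ~ exists (G : sgraph) (v : G),
      game_domination_number G = 4 /\
      game_domination_number (del_vertex v) = 2.
Proof.
by case=> G [v [G4 /del_vertex_game_domination_number_eq2]]; rewrite G4.
Qed.
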